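(* Let $\beta$ be a nonzero ordinal and let $s$ be a sequence of length $\beta$ which is the cardinal sequence of some LLSP space. Then: (1) $|\beta|\le 2^{s(0)}$, and $s(\alpha)\le 2^{s(0)}$ for each $\alpha<\beta$. (2) If $\alpha+1<\beta$, then $s(\alpha+1)\le s(\alpha)^{\omega_1}$. (3) If $\delta<\beta$ is a limit ordinal with $\operatorname{cf}(\delta)>\omega$ and $C$ is any cofinal subset of $\delta$, then $s(\delta)\le\prod\{s(\alpha):\alpha\in C\}$.
   Context: An LLSP space is a locally Lindelöf (every point has a Lindelöf neighborhood), scattered, Hausdorff P-space; a P-space is a space in which the intersection of every countable family of open sets is open. For a topological space $X$ and an ordinal $\alpha$, $I_\alpha(X)$ is the set of isolated points of the subspace $X\setminus\bigcup\{I_\beta(X):\beta<\alpha\}$; $X$ is scattered if $X=\bigcup\{I_\beta(X):\beta<\alpha\}$ for some ordinal $\alpha$. The cardinal sequence of a scattered space $X$ is $\langle |I_\alpha(X)|:\alpha<\delta\rangle$, where $\delta$ is the least ordinal $\gamma$ such that $I_\gamma(X)$ is finite. The product in (3) is the cardinal product. *)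

(* Defs.v *)
From HB Require Import structures.
From mathcomp Require Import all_boot all_order.
From mathcomp Require Import all_classical wochoice topology.

Set Implicit Arguments.
Unset Strict Implicit.
Unset Printing Implicit Defensive.

Import Order.TTheory.

Local Open Scope classical_set_scope.
Local Open Scope card_scope.
Local Open Scope order_scope.

(* An ordinal is represented by a well-ordered type B, the ordinals below it by
   the elements of B: a : B stands for the order type of [set b | b < a].
   A cardinal is represented by a type of that cardinality, and cardinals are
   compared by #<= and #= on full sets.  Thus K -> L represents the power L^K
   and a dependent function type represents a cardinal product. *)
HB.mixin Record Total_isWellOrder (d : Order.disp_t) T of Order.Total d T := {
  lt_wf : well_founded (fun x y : T => x < y)
}.

#[short(type="wellOrderType")]
HB.structure Definition WellOrder (d : Order.disp_t) :=
  {T of Order.Total d T & Total_isWellOrder d T}.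

Section OrdinalNotions.
Context {d : Order.disp_t} {B : wellOrderType d}.
Implicit Types (a b delta : B) (C : set B).

Definition is_zero a := forall b, a <= b.

Definition is_succ a a' := a < a' /\ forall b, a < b -> a' <= b.

Definition is_limit delta :=
  ~ is_zero delta /\ forall a, ~ is_succ a delta.

Definition cofinal delta C :=
  C `<=` [set a | a < delta] /\
  forall a, a < delta -> exists2 c, C c & a <= c.

(* kappa represents cf(delta), the least cardinality of a cofinal subset. *)
Definition is_cofinality delta (kappa : Type) :=
  (exists2 C, cofinal delta C & [set: kappa] #= C) /\
  forall C, cofinal delta C -> [set: kappa] #<= C.

End OrdinalNotions.

Section Levels.
Context (X : topologicalType).

Section Level.
Context {d : Order.disp_t} {B : wellOrderType d}.

(* level a is I_a(X); levelE below is the defining recursion. *)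
Definition level : B -> set X := Fix lt_wf (fun=> set X)
  (fun a rec =>
     isolated (~` [set x | exists b (ltba : b < a), rec b ltba x])).

Lemma levelE a :
  level a = isolated (~` \bigcup_(b in [set b | b < a]) level b).
Proof.
rewrite /level Fix_eq /=; last first.
  move=> b f g fg; congr (isolated (~` _)); apply/seteqP.
  by split=> x [c [ltcb h]]; exists c, ltcb; rewrite ?fg// -fg.
congr (isolated (~` _)); apply/seteqP; split=> x.
- by move=> [b [ltba h]]; exists b.
- by move=> [b ltba h]; exists b, ltba.
Qed.

End Level.

(* I_B(X), for the ordinal B itself. *)
Definition level_of (d : Order.disp_t) (B : wellOrderType d) : set X :=
  isolated (~` \bigcup_(b in [set: B]) level b).

Definition scattered :=
  exists (d : Order.disp_t) (A : wellOrderType d),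
    \bigcup_(a in [set: A]) level a = [set: X].

Definition P_space :=
  forall F : set (set X), countable F -> F `<=` open ->
    open (\bigcap_(U in F) U).

Definition lindelof (A : set X) :=
  forall F : set (set X), F `<=` open -> A `<=` \bigcup_(U in F) U ->
    exists2 G, G `<=` F & countable G /\ A `<=` \bigcup_(U in G) U.

Definition locally_lindelof :=
  forall x : X, exists2 U, nbhs x U & lindelof U.

Definition LLSP :=
  [/\ locally_lindelof, scattered, hausdorff_space X & P_space].

(* The first two clauses say that B is the least ordinal whose level is
   finite, i.e. the length of the cardinal sequence of X. *)
Definition cardinal_sequence (d : Order.disp_t) (B : wellOrderType d)
    (s : B -> Type) :=
  [/\ finite_set (level_of B),
      forall a : B, infinite_set (level a) &
      forall a : B, [set: s a] #= level a].

End Levels.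

(* omega_1, realized inside a well-ordering of the subsets of nat as the initial
   segment of the points with countably many predecessors.  Being an uncountable
   well-order with countable proper initial segments (the last two lemmas below)
   determines it up to isomorphism. *)
Definition set_nat_le : rel (set nat) :=
  sval (well_ordering_principle (set nat)).

Lemma set_nat_le_wo : wo_chain set_nat_le predT.
Proof.
by apply: withinW => A; apply: (svalP (well_ordering_principle (set nat))).
Qed.

Lemma set_nat_le_total : total set_nat_le.
Proof. by move=> x y; apply: (wo_chainW set_nat_le_wo). Qed.

Lemma set_nat_le_anti : antisymmetric set_nat_le.
Proof. by move=> x y; apply: (wo_chain_antisymmetric set_nat_le_wo). Qed.

Lemma set_nat_le_min (A : set (set nat)) : A !=set0 ->
  exists2 m, A m & forall x, A x -> set_nat_le m x.
Proof.
move=> [x Ax]; have [||m [[/asboolP Am lm] _]] :=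
    @set_nat_le_wo (fun y => `[< A y >]) => //.
  by exists x; apply/asboolP.
by exists m => // y /asboolP; apply: lm.
Qed.

Lemma set_nat_le_trans : transitive set_nat_le.
Proof.
move=> y x z xy yz.
have [|m xyzm mle] := @set_nat_le_min [set x; y; z]; first by exists x; do 2 left.
have [mx my mz] : [/\ set_nat_le m x, set_nat_le m y & set_nat_le m z].
  by split; apply: mle; [do 2 left|left; right|right].
move: xyzm => [[|]|] /= mE; subst m => //.
- by rewrite (@set_nat_le_anti x y) ?xy.
- by rewrite -(@set_nat_le_anti y z) ?yz.
Qed.

Definition omega1_pred : pred (set nat) :=
  fun x => `[< countable [set y | (y != x) && set_nat_le y x] >].

Record omega1 := Omega1 { omega1_val :> set nat; _ : omega1_pred omega1_val }.

HB.instance Definition _ := [isSub for omega1_val].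
HB.instance Definition _ := [Choice of omega1 by <:].

Fact omega1_display : Order.disp_t. Proof. exact: Order.Disp tt tt. Qed.

Definition omega1_le (x y : omega1) := set_nat_le x y.

Lemma omega1_le_anti : antisymmetric omega1_le.
Proof. by move=> x y /set_nat_le_anti/val_inj. Qed.

Lemma omega1_le_trans : transitive omega1_le.
Proof. by move=> y x z; apply: set_nat_le_trans. Qed.

Lemma omega1_le_total : total omega1_le.
Proof. by move=> x y; apply: set_nat_le_total. Qed.

HB.instance Definition _ := @Order.isOrder.Build omega1_display omega1
  omega1_le (fun x y => (y != x) && omega1_le x y)
  _ _ (fun _ _ => erefl) (fun _ _ => erefl) (fun _ _ => erefl)
  omega1_le_anti omega1_le_trans omega1_le_total.

Lemma omega1_lt_wf : well_founded (fun x y : omega1 => x < y).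
Proof.
move=> x; apply: contrapT => nx.
pose N := [set y | ~ Acc (fun x y : omega1 => x < y) y].
have [|m [w nw <-] lm] := @set_nat_le_min (omega1_val @` N); first by exists x, x.
apply: nw; constructor => y; rewrite ltNge => /negP yw.
by apply: contrapT => ny; apply: yw; apply: lm; exists y.
Qed.

HB.instance Definition _ :=
  Total_isWellOrder.Build omega1_display omega1 omega1_lt_wf.

Lemma omega1_countable_seg (x : omega1) : countable [set y | y < x].
Proof.
have /asboolP cx : omega1_pred x by case: x.
rewrite -(eq_countable (inj_card_eq (in2W val_inj))).
apply: sub_countable cx; apply: subset_card_le => _ [y yx <-].
by rewrite /= eq_sym; exact: yx.
Qed.

Lemma omega1_uncountable : ~ countable [set: omega1].
Proof.
rewrite -(eq_countable (inj_card_eq (in2W val_inj))) => c1.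
have [all1|] := pselect (forall x, omega1_pred x).
  have : countable [set: set nat].
    by apply: sub_countable c1; apply: subset_card_le => x _; exists (Omega1 (all1 x)).
  move=> /countable_injP[f finj]; pose D := [set n | exists2 A, n = f A & ~ A n].
  have [DfD|nDfD] := pselect (D (f D)); last by apply: (nDfD); exists D.
  by have [A fDA nA] := DfD; apply: (nA); rewrite -(finj _ _ _ _ fDA) ?inE.
move=> /existsNP[x0 nx0].
have [|x nx xmin] := @set_nat_le_min [set x | ~ omega1_pred x]; first by exists x0.
apply: nx; apply/asboolP; apply: sub_countable c1; apply: subset_card_le.
move=> y /= /andP[yx ylex]; have [oy|ny] := pselect (omega1_pred y).
  by exists (Omega1 oy).
by move: yx; rewrite (@set_nat_le_anti y x) ?eqxx// ylex xmin.
Qed.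

(* Main.v *)
Require Import Defs.
From mathcomp Require Import all_boot all_order.
From mathcomp Require Import all_classical topology.

(** All three bounds come from coding a point of an LLSP space X injectively by
    points of lower Cantor-Bendixson levels that converge to it.

    Lindelöf sets in a Hausdorff P-space behave like compact sets in a
    Hausdorff space: they can be separated from points and are closed.  Hence
    every point x of level a has a closed Lindelöf neighbourhood U_x, a cone at
    x, all of whose other points lie strictly below level a ([level_cone]).
    Scatteredness makes level a dense in the set of the points that are not
    below level a ([level_dense]).

    (1) A point x is determined by the set of the isolated points in the
    interior of U_x: these are dense in the interior of U_x, so if x and y have
    the same code then each lies in the closed cone of the other, and distinct
    points would each have a level smaller than the other ([points_inj_traces]).
    Levels are nonempty and disjoint, so the ordinal beta injects into X as
    well.

    (2) If x has level a + 1, then U_x has uncountably many points of level a,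
    since countable sets are closed and x is a limit of level a.  Outside any
    neighbourhood of x there are only countably many of them, because U_x is
    Lindelöf.  So any injective family of omega_1 points of level a in U_x
    converges to x, and determines x ([succ_level_inj]).

    (3) If x has level delta, choose a point of level c in U_x for each c in C.
    Outside a neighbourhood of x, the Lindelöf set U_x is covered by countably
    many sets whose points have levels bounded below delta, so by uncountable
    cofinality it lies below a single a < delta.  The chosen points therefore
    converge to x along C, and determine x ([limit_level_inj]). *)

Set Implicit Arguments.
Unset Strict Implicit.
Unset Printing Implicit Defensive.

Import Order.TTheory.

Local Open Scope order_scope.
Local Open Scope classical_set_scope.
Local Open Scope card_scope.

(** * Cardinalities and omega_1 *)

Lemma injective_card_le (S T : Type) (f : S -> T) :
  injective f -> [set: S] #<= [set: T].
Proof.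
move=> finj; rewrite -(card_le_eql (inj_card_eq (in2W finj))).
exact: subset_card_le.
Qed.

Lemma card_setT_eqP (S T : Type) (A : set T) : [set: S] #= A ->
  exists h : S -> T, injective h /\ range h = A.
Proof.
move=> /card_bijP[f [g fK gK]].
exists (fun t => val (f (to_setT t))); split.
  by move=> t u /val_inj /(can_inj fK) /(congr1 val).
apply/seteqP; split=> [_ [t _ <-]|x Ax]; first exact: set_valP.
exists (val (g (SigSub (mem_set Ax)))) => //=.
rewrite (_ : to_setT _ = g (SigSub (mem_set Ax))) ?gK//.
exact: val_inj.
Qed.

(** omega_1 is the least uncountable cardinal.  The values are chosen by
    recursion: the earlier values form a countable set, as proper initial
    segments of omega_1 are countable, so they cannot exhaust A. *)
Lemma omega1_inj (T : Type) (A : set T) : ~ countable A ->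
  exists2 f : omega1 -> T, injective f & forall i, A (f i).
Proof.
move=> Anc.
have fresh_pt (D : set T) : countable D -> {x | A x /\ ~ D x}.
  move=> cD; apply: cid; apply: contrapT => no; apply: Anc.
  apply: sub_countable cD; apply: subset_card_le => x Ax.
  by apply: contrapT => Dx; apply: no; exists x.
have cprev (i : omega1) (rec : forall j, j < i -> T) :
    countable [set x | exists j (ji : j < i), rec j ji = x].
  pose G j := [set x | exists ji : j < i, rec j ji = x].
  suff : countable (\bigcup_(j in [set j | j < i]) G j).
    apply: sub_countable; apply: subset_card_le => x [j [ji <-]].
    by exists j => //; exists ji.
  apply: bigcup_countable => [|j ji]; first exact: omega1_countable_seg.
  apply: sub_countable (countable1 (rec j ji)); apply: subset_card_le.
  by move=> _ [ji' <-]; rewrite (bool_irrelevance ji' ji).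
pose F := Fix omega1_lt_wf (fun=> T)
  (fun i rec => sval (fresh_pt _ (cprev i rec))).
have FE i : A (F i) /\ forall j, j < i -> F j <> F i.
  rewrite [F i]Fix_eq; last first.
    move=> j f g fg; suff -> : f = g by [].
    apply functional_extensionality_dep => k.
    by apply functional_extensionality_dep => kj; apply: fg.
  case: (fresh_pt _ _) => x [Ax nx] /=; split=> // j ji Fj.
  by apply: nx; exists j, ji.
exists F => [i j Fij|i]; last by have [] := FE i.
case: (ltgtP i j) => // ij; first by case: (FE j) => _ /(_ i ij).
by case: (FE i) => _ /(_ j ij); rewrite Fij.
Qed.

(** * Lindelöf sets in Hausdorff P-spaces *)

Section LindelofPSpaces.
Context (X : topologicalType).

Lemma lindelof_closedI (K F : set X) :
  lindelof K -> closed F -> lindelof (K `&` F).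
Proof.
move=> lK cF G Gop KFG.
have [||H HG [cH KH]] := lK (G `|` [set ~` F]).
- by move=> U [/Gop//|->]; rewrite openC.
- move=> x Kx; have [Fx|nFx] := pselect (F x); last by exists (~` F) => //; right.
  by have [U GU Ux] := KFG x (conj Kx Fx); exists U => //; left.
exists (H `&` G) => [U []//|]; split.
  by apply: sub_countable cH; apply: subset_card_le => U [].
move=> x [Kx Fx]; have [U HU Ux] := KH _ Kx.
by exists U => //; split=> //; case: (HG _ HU) => // UE; move: Ux; rewrite UE.
Qed.

Context (hX : hausdorff_space X).
Context (pX : P_space X).

Lemma hausdorff_separate (x y : X) : x <> y ->
  exists V W : set X, [/\ open V, open W, V x, W y & forall z, V z -> ~ W z].
Proof.
move: hX; rewrite open_hausdorff => h /eqP /h[[V W]] /= [/set_mem Vx /set_mem Wy].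
move=> [oV oW /eqP VW]; exists V, W; split=> // z Vz Wz.
by suff : set0 z by []; rewrite -VW.
Qed.

(** The definition of a P-space speaks of countable sets of open sets; this is
    the version for countably indexed families. *)
Lemma P_space_bigcap (I : Type) (D : set I) (F : I -> set X) :
  countable D -> (forall i, D i -> open (F i)) -> open (\bigcap_(i in D) F i).
Proof.
move=> cD oF; rewrite -(bigcap_image D F id); apply: pX => [|_ [i Di <-]].
  exact: sub_countable (card_image_le F D) cD.
exact: oF.
Qed.

Lemma countable_closed (D : set X) : countable D -> closed D.
Proof.
move=> cD; rewrite -openC.
rewrite (_ : ~` D = \bigcap_(x in D) ~` [set x]); last first.
  apply/seteqP; split=> [y nDy x Dx yx|y h Dy]; last by apply: (h y).
  by apply: nDy; rewrite yx.
apply: P_space_bigcap => // x _; rewrite openC.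
by apply: accessible_closed_set1; apply: hausdorff_accessible.
Qed.

(** The argument for compact sets, with a countable instead of a finite
    subcover: the intersection of the corresponding neighbourhoods of x is
    still open because X is a P-space. *)
Lemma lindelof_separate (K : set X) (x : X) : lindelof K -> ~ K x ->
  exists V W : set X,
    [/\ open V, open W, V x, K `<=` W & forall z, V z -> ~ W z].
Proof.
move=> lK nKx.
pose G := [set W | open W /\ exists2 V, open V /\ V x & forall z, V z -> ~ W z].
have [W []//|y Ky|H HG [cH KH]] := lK G.
  have xy : x <> y by move=> xy; apply: nKx; rewrite xy.
  have [V [W [oV oW Vx Wy VW]]] := hausdorff_separate xy.
  by exists W => //; split=> //; exists V.
have /choice[v vP] W : exists V, H W -> [/\ open V, V x & forall z, V z -> ~ W z].
  have [/HG[_ [V [oV Vx] VW]]|] := pselect (H W); first by exists V.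
  by move=> nHW; exists setT.
exists (\bigcap_(W in H) v W), (\bigcup_(W in H) W); split=> //.
- by apply: P_space_bigcap => // W /vP[].
- by apply: bigcup_open => W /HG[].
- by move=> W /vP[].
- by move=> z zv [W HW]; have [_ _] := vP _ HW; apply; apply: zv.
Qed.

Lemma lindelof_closed (K : set X) : lindelof K -> closed K.
Proof.
move=> lK; rewrite -openC openE => x nKx.
have [V [W [oV _ Vx KW VW]]] := lindelof_separate lK nKx.
apply: filterS (open_nbhs_nbhs (conj oV Vx)) => z Vz Kz.
exact: VW Vz (KW _ Kz).
Qed.

Context (lX : locally_lindelof X).

(** Regularity: in a Lindelöf neighbourhood K of x, the part of K outside the
    interior of O is Lindelöf and misses x, so it can be separated from x. *)
Lemma lindelof_closed_nbhs (x : X) (O : set X) : nbhs x O ->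
  exists U, [/\ nbhs x U, closed U, lindelof U & U `<=` O].
Proof.
move=> Ox; have [K Kx lK] := lX x.
have [||V [W [oV oW Vx KW VW]]] :=
    @lindelof_separate (K `&` ~` O°) x (lindelof_closedI lK _).
- by rewrite closedC; exact: open_interior.
- by move=> [_]; apply; exact: nbhs_singleton (nbhs_interior Ox).
have cW : closed (~` W) by rewrite closedC.
exists (K `&` ~` W); split.
- apply: filterI => //; apply: filterS (open_nbhs_nbhs (conj oV Vx)).
  exact: VW.
- by apply: closedI => //; exact: lindelof_closed.
- exact: lindelof_closedI.
- move=> z [Kz nWz]; apply: interior_subset; apply: contrapT => nOz.
  by apply: nWz; apply: KW.
Qed.

End LindelofPSpaces.

(** * Cantor-Bendixson levels *)

Section CantorBendixson.
Context (X : topologicalType) (d : Order.disp_t) (B : wellOrderType d).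
Implicit Types (a b : B) (x y : X).

Definition below a : set X := \bigcup_(b in [set b | b < a]) level b.

Lemma level_nbhs a x : level a x ->
  ~ below a x /\ exists2 O, open O /\ O x & O `\ x `<=` below a.
Proof.
rewrite levelE -/(below a) => -[/set_mem nx [V Vx VE]]; split=> //.
exists V°; first by split; [exact: open_interior|].
move=> y [/interior_subset Vy yx]; apply: contrapT => ny.
by apply: yx; rewrite -VE; split.
Qed.

Lemma level_inj a b x : level a x -> level b x -> a = b.
Proof.
move=> ax bx; have [nax _] := level_nbhs ax; have [nbx _] := level_nbhs bx.
case: (ltgtP a b) => // [ab|ba]; [case: nbx|case: nax]; first by exists a.
by exists b.
Qed.

(** A point of level b has a neighbourhood whose other points lie below b. *)
Lemma open_below a : open (below a).
Proof.
rewrite openE => x [b /= ba bx]; have [_ [O [oO Ox] Ob]] := level_nbhs bx.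
apply: filterS (open_nbhs_nbhs (conj oO Ox)) => y Oy.
have [->|yx] := pselect (y = x); first by exists b.
by have [c /= cb cy] := Ob _ (conj Oy yx); exists c => //=; apply: lt_trans ba.
Qed.

End CantorBendixson.

(** The well-order that witnesses scatteredness need not be the one that
    indexes the cardinal sequence.  This consequence is free of it: a point of
    S of least level is isolated in S. *)
Lemma scattered_isolated (X : topologicalType) (S : set X) :
  scattered X -> S !=set0 -> isolated S !=set0.
Proof.
move=> [d [A levA]] [x0 Sx0].
have rank (x : X) : exists a : A, level a x.
  by have : [set: X] x by []; rewrite -levA => -[a _ ax]; exists a.
have [a0] := rank x0; elim/(well_founded_ind (@lt_wf d A)): a0 x0 Sx0 => a IH x Sx ax.
have [[b [ba [y [Sy yb]]]]|nb] := pselect (exists b, b < a /\ S `&` level b !=set0).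
  exact: (IH b ba y).
have [_ [O [oO Ox] Oa]] := level_nbhs ax.
exists x; split; first exact: mem_set.
exists O; first exact: open_nbhs_nbhs.
apply/seteqP; split=> [y [Oy Sy]|_ ->] //; apply: contrapT => yx.
by have [b /= ba yb] := Oa _ (conj Oy yx); apply: nb; exists b; split=> //; exists y.
Qed.

(** * Coding points of LLSP spaces by lower levels *)

Section LLSPSpaces.
Context (X : topologicalType) (hX : LLSP X).
Context (d : Order.disp_t) (B : wellOrderType d).
Implicit Types (a b c : B) (x y : X).

Let lX : locally_lindelof X. Proof. by case: hX. Qed.
Let sX : scattered X. Proof. by case: hX. Qed.
Let h2X : hausdorff_space X. Proof. by case: hX. Qed.
Let pX : P_space X. Proof. by case: hX. Qed.

(** By scatteredness the part of O not below level a has an isolated point; as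
    O is open, that point is isolated in the whole set of points not below
    level a. *)
Lemma level_dense a x (O : set X) :
  open O -> O x -> ~ below a x -> exists2 y, O y & level a y.
Proof.
move=> oO Ox nax.
have [|y [/set_mem[Oy nay] [V Vy VE]]] := @scattered_isolated X (O `&` ~` below a) sX.
  by exists x.
exists y => //; rewrite levelE -/(below a); split; first exact: mem_set.
exists (V `&` O); last by rewrite -setIA.
by apply: filterI => //; apply: open_nbhs_nbhs.
Qed.

Lemma level_cone a x : level a x ->
  exists U, [/\ nbhs x U, closed U, lindelof U & U `\ x `<=` below a].
Proof.
move=> /level_nbhs[_ [O [oO Ox] Oa]].
have [U [Ux cU lU UO]] := lindelof_closed_nbhs h2X pX lX (open_nbhs_nbhs (conj oO Ox)).
by exists U; split=> // y [/UO Oy yx]; apply: Oa.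
Qed.

(** The top level of L is a closed discrete part of the Lindelöf set L: every
    point of L has an open neighbourhood with at most one point of level a. *)
Lemma lindelof_top_countable a (L : set X) : lindelof L ->
  L `<=` below a `|` level a -> countable (L `&` level a).
Proof.
move=> lL La.
pose G := [set O : set X | open O /\ exists p, O `&` level a `<=` [set p]].
have [O []//|x Lx|H HG [cH LH]] := lL G.
  have [xa|/level_nbhs[_ [O [oO Ox] Oa]]] := La _ Lx.
    exists (below a) => //; split; first exact: open_below.
    by exists x => y [[b /= ba yb] /level_nbhs[]]; case; exists b.
  exists O => //; split=> //; exists x => y [Oy ya]; apply: contrapT => yx.
  by have [] := level_nbhs ya; case; apply: Oa.
suff : countable (\bigcup_(O in H) (O `&` level a)).
  apply: sub_countable; apply: subset_card_le => x [/LH[O HO Ox] xa].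
  by exists O.
apply: bigcup_countable => // O /HG[_ [p Op]].
exact: sub_countable (subset_card_le Op) (countable1 p).
Qed.

(** The code of x is the set of the isolated points in the interior of a cone
    at x. *)
Lemma points_inj_traces (z : B) : is_zero z ->
  exists D : X -> set X, (forall x, D x `<=` level z) /\
    forall a b x y, level a x -> level b y -> D x = D y -> x = y.
Proof.
move=> z0.
have nz x : ~ below z x.
  by move=> [b /= bz _]; move: (z0 b); rewrite leNgt bz.
have /choice[U UP] x : exists U, forall a, level a x ->
    [/\ nbhs x U, closed U, lindelof U & U `\ x `<=` below a].
  have [[a ax]|na] := pselect (exists a, level a x); last first.
    by exists setT => a ax; case: na; exists a.
  by have [U UP] := level_cone ax; exists U => b bx; rewrite -(level_inj ax bx).
exists (fun x => (U x)° `&` level z); split=> [x y []//|].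
(* The isolated points in the interior of U x accumulate at x, so equal codes
   put x in the closed set U y. *)
have key a x y b : level a x -> level b y ->
    (U x)° `&` level z = (U y)° `&` level z -> U y x.
  move=> ax yb Dxy; have [Ux _ _ _] := UP _ _ ax; have [_ cU _ _] := UP _ _ yb.
  apply: cU => V Vx.
  have [||t [/= Ut Vt] tz] := @level_dense z x ((U x)° `&` V°) _ _ (nz x).
  - by apply: openI; exact: open_interior.
  - by split; apply: nbhs_singleton; exact: nbhs_interior.
  exists t; split; last exact: interior_subset.
  have [] : ((U y)° `&` level z) t by rewrite -Dxy.
  by move=> /interior_subset.
move=> a b x y ax yb Dxy; apply: contrapT => xy.
have [_ _ _ Ua] := UP _ _ ax; have [_ _ _ Ub] := UP _ _ yb.
have [c /= cb xc] : below b x.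
  by apply: Ub; split=> //; apply: key ax yb Dxy.
have [e /= ea ye] : below a y.
  by apply: Ua; split=> [|/esym//]; apply: key yb ax (esym Dxy).
have ca := level_inj ax xc; have be := level_inj yb ye; subst c e.
by have := lt_trans cb ea; rewrite ltxx.
Qed.

(** The code of x is an injective family of omega_1 points of level a in a cone
    at x, all but countably many of which lie in any given neighbourhood of x.
    Two distinct points have disjoint neighbourhoods, so a common code would
    make omega_1 countable. *)
Lemma succ_level_inj a a' : is_succ a a' ->
  exists F : X -> omega1 -> X,
    (forall x, level a' x -> forall i, level a (F x i)) /\
    forall x y, level a' x -> level a' y -> F x = F y -> x = y.
Proof.
move=> [aa' succ].
have belowS : (below a' : set X) `<=` below a `|` level a.
  move=> y [b /= ba' yb]; have [ba|ab|ba] := ltgtP b a; last by right; rewrite -ba.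
    by left; exists b.
  by have := succ _ ab; rewrite leNgt ba'.
have /choice[F FP] x : exists F : omega1 -> X, level a' x ->
    [/\ injective F, forall i, level a (F i) &
      forall V, open V -> V x -> countable [set i | ~ V (F i)]].
  have [xa'|] := pselect (level a' x); last by exists (fun=> x).
  have [U [Ux cU lU Ua']] := level_cone xa'; have [nx _] := level_nbhs xa'.
  have nxa : ~ level a x by move=> xa; apply: nx; exists a.
  have [|F Finj FU] := @omega1_inj X (U `&` level a).
    (* Otherwise the interior of U minus these countably many points is a
       neighbourhood of x that misses level a, against density. *)
    move=> cUa.
    have [|||y [/= Uy nUy] ya] := @level_dense a x (U° `&` ~` (U `&` level a)).
    - apply: openI; first exact: open_interior.
      by rewrite openC; exact: countable_closed.
    - by split=> [|[]//]; apply: nbhs_singleton; exact: nbhs_interior.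
    - by move=> [b /= ba xb]; apply: nx; exists b => //=; apply: lt_trans aa'.
    by apply: nUy; split=> //; exact: interior_subset.
  exists F => _; split=> // [i|V oV Vx]; first by case: (FU i).
  have : countable (U `&` ~` V `&` level a).
    apply: lindelof_top_countable.
      by apply: lindelof_closedI => //; rewrite closedC.
    by move=> y [Uy nVy]; apply/belowS/Ua'; split=> // yx; apply: nVy; rewrite yx.
  apply: sub_countable; rewrite -(card_le_eql (inj_card_eq (in2W Finj))).
  apply: subset_card_le => _ [i nV <-].
  by have [] := FU i.
exists F; split=> [x /FP[]//|x y xa' ya' Fxy]; apply: contrapT => xy.
have [Finj _ Fx] := FP _ xa'; have [_ _ Fy] := FP _ ya'.
have [V [W [oV oW Vx Wy VW]]] := hausdorff_separate h2X xy.
apply: omega1_uncountable.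
have : countable (\bigcup_(b in [set: bool])
    if b then [set i | ~ V (F x i)] else [set i | ~ W (F y i)]).
  by apply: bigcup_countable => // -[] _; [exact: Fx|exact: Fy].
apply: sub_countable; apply: subset_card_le => i _.
have [Vi|nV] := pselect (V (F x i)); last by exists true.
by exists false; rewrite //= -Fxy; apply: VW.
Qed.

(** The code of x selects from a cone at x a point of each level c in C.  The
    hypothesis on countable sets is uncountable cofinality of delta; it makes
    every neighbourhood of x contain the selected points from some level on. *)
Lemma limit_level_inj (delta : B) (C : set B) :
    (forall D : set B, countable D -> ~ cofinal delta D) -> cofinal delta C ->
  exists F : X -> C -> X,
    (forall x, level delta x -> forall c : C, level (\val c) (F x c)) /\
    forall x y, level delta x -> level delta y -> F x = F y -> x = y.
Proof.
move=> cf [Cdelta Ccof].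
have /choice[F FP] x : exists F : C -> X, level delta x ->
    (forall c : C, level (\val c) (F c)) /\
    forall V, open V -> V x ->
      exists2 a, a < delta & forall c : C, a <= \val c -> V (F c).
  have [xd|] := pselect (level delta x); last by exists (fun=> x).
  have [U [Ux cU lU Ud]] := level_cone xd; have [nx _] := level_nbhs xd.
  have /choice[F FU] (c : C) : exists y, U y /\ level (\val c) y.
    have [|||y] := @level_dense (\val c) x U°; first exact: open_interior.
    - by apply: nbhs_singleton; exact: nbhs_interior.
    - move=> [b /= bc xb]; apply: nx; exists b => //=.
      by apply: lt_trans bc _; apply: Cdelta; exact: set_valP.
    by move=> /interior_subset; exists y.
  exists F => _; split=> [c|V oV Vx]; first by case: (FU c).
  pose G := [set O : set X | open O /\
    exists2 a, a < delta & O `<=` below a `|` level a].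
  have lUV : lindelof (U `&` ~` V) by apply: lindelof_closedI => //; rewrite closedC.
  have [O []//|y [Uy nVy]|H HG [cH UH]] := lUV G.
    have [|a /= ad ya] := Ud y; first by split=> // yx; apply: nVy; rewrite yx.
    have [_ [O [oO Oy] Oa]] := level_nbhs ya; exists O => //; split=> //.
    exists a => // z Oz; have [->|zy] := pselect (z = y); first by right.
    by left; apply: Oa.
  have /choice[r rP] (O : set X) : exists a, H O ->
      a < delta /\ O `<=` below a `|` level a.
    have [/HG[_ [a ad Oa]]|nH] := pselect (H O); first by exists a.
    by exists delta.
  (* The countably many bounds r O, for O in H, are not cofinal in delta. *)
  have [a ad ra] : exists2 a, a < delta & forall O, H O -> r O < a.
    apply: contrapT => na.
    apply: (cf (r @` H)); first exact: sub_countable (card_image_le r H) cH.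
    split=> [_ [O /rP[rd _] <-]//|a ad]; apply: contrapT => nr; apply: na.
    exists a => // O HO; rewrite ltNge; apply/negP => ar.
    by apply: nr; exists (r O) => //; exists O.
  exists a => // c ac; apply: contrapT => nV; have [Uc Fc] := FU c.
  have [O HO Oc] := UH _ (conj Uc nV); have [_ /(_ _ Oc) Or] := rP _ HO.
  have [b ba bc] : exists2 b, b < a & level b (F c).
    case: Or => [[b /= br bc]|]; last by exists (r O) => //; exact: ra.
    by exists b => //; apply: lt_trans br (ra _ HO).
  by move: ba; rewrite (level_inj bc Fc) ltNge ac.
exists F; split=> [x /FP[]//|x y xd yd Fxy]; apply: contrapT => xy.
have [_ Fx] := FP _ xd; have [_ Fy] := FP _ yd.
have [V [W [oV oW Vx Wy VW]]] := hausdorff_separate h2X xy.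
have [a ad Va] := Fx _ oV Vx; have [b bd Wb] := Fy _ oW Wy.
have [|c Cc abc] := Ccof (Order.max a b); first by rewrite gt_max ad bd.
move: abc; rewrite ge_max => /andP[ac bc].
pose c' : C := SigSub (mem_set Cc).
by apply: (VW (F x c')); [exact: Va|rewrite Fxy; exact: Wb].
Qed.

End LLSPSpaces.

Theorem theorem3p3 (d : Order.disp_t) (beta : wellOrderType d)
    (s : beta -> Type) (beta_nonzero : inhabited beta)
    (hs : exists X : topologicalType, LLSP X /\ cardinal_sequence X s) :
  [/\ forall z : beta, is_zero z ->
        [set: beta] #<= [set: s z -> bool] /\
        forall alpha : beta, [set: s alpha] #<= [set: s z -> bool],
      forall alpha alpha' : beta, is_succ alpha alpha' ->
        [set: s alpha'] #<= [set: omega1 -> s alpha] &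
      forall (delta : beta) (kappa : Type),
        is_limit delta -> is_cofinality delta kappa ->
        ~ countable [set: kappa] ->
        forall C : set beta, cofinal delta C ->
          [set: s delta] #<= [set: forall alpha : C, s (\val alpha)]].
Proof.
have [X [hX [_ inf card]]] := hs.
have hP' a : {h : s a -> X | injective h /\ range h = level a}.
  by apply: cid; exact: card_setT_eqP.
pose h a := sval (hP' a).
have hP a : injective (h a) /\ range (h a) = level a := svalP (hP' a).
have hl a t : level a (h a t) by have [_ <-] := hP a; exists t.
have hinj a : injective (h a) by case: (hP a).
have hsurj a x : level a x -> exists t, h a t = x.
  by have [_ <-] := hP a; case=> t _ <-; exists t.
split.
- move=> z z0; have [D [Dz Dinj]] := points_inj_traces hX z0.
  pose E x : s z -> bool := fun t => `[< D x (h z t) >].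
  have Einj (a b : beta) x y : level a x -> level b y -> E x = E y -> x = y.
    have E_sub u v : E u = E v -> D u `<=` D v.
      move=> Euv p Dp; have [t tp] := hsurj _ _ (Dz _ _ Dp).
      by move: Dp; rewrite -tp => /asboolP; rewrite -/(E u t) Euv => /asboolP.
    move=> ax by_ Exy; apply: (Dinj _ _ _ _ ax by_).
    by apply/seteqP; split; apply: E_sub.
  split=> [|a]; last first.
    apply: (@injective_card_le _ _ (fun t => E (h a t))) => t u /Einj tu.
    by apply: (hinj a); apply: tu.
  have /choice[p pP] (a : beta) : exists x : X, level a x.
    by apply: infinite_setN0; exact: inf.
  apply: (@injective_card_le _ _ (fun a => E (p a))) => a b Eab.
  apply: (@level_inj X _ _ a b (p a)) => //.
  by rewrite (Einj _ _ _ _ (pP a) (pP b) Eab).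
- move=> a a' /(succ_level_inj hX)[F [Fa Finj]].
  have /choice[G GP] (t : s a') : exists g : omega1 -> s a,
      forall i, h a (g i) = F (h a' t) i.
    have /choice[g gP] i := hsurj _ _ (Fa _ (hl a' t) i).
    by exists g.
  apply: (@injective_card_le _ _ G) => t u Gtu.
  apply: (hinj a'); apply: Finj => //.
  by apply/funext => i; rewrite -!GP Gtu.
- move=> delta kappa _ [_ minkappa] unc C Ccof.
  have [|F [Fc Finj]] := limit_level_inj hX _ Ccof.
    by move=> D cD /minkappa kD; apply: unc; exact: sub_countable kD cD.
  have ex (t : s delta) (c : C) : {u : s (\val c) | h _ u = F (h _ t) c}.
    by apply: cid; apply: (hsurj); apply: (Fc); exact: hl.
  apply: (@injective_card_le _ _ (fun t c => sval (ex t c))) => t u tu.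
  apply: (hinj delta); apply: Finj => //; apply/funext => c.
  by rewrite -(svalP (ex t c)) -(svalP (ex u c)) (congr1 (@^~ c) tu).
Qed.
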